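(* Let $S$ be a commutative unital ring, $Q$ a group, $\kappa_Q\colon Q\to\mathrm{Aut}(S)$ an action by ring automorphisms, $R=S^Q$. The Teichmüller class of a $Q$-normal $S$-algebra $(A,\sigma)$ is zero if and only if $A$ admits a strong Deuring embedding $(C,\chi\colon Q\to N^{\mathrm U(C)}(A)/\mathrm U(A))$ relative to $\kappa_Q$ into an algebra $C$ over $R$ that induces the $Q$-normal structure $\sigma$ on $A$, i.e. $\eta_\sharp\circ\chi=\sigma$. Hence a central $S$-algebra $A$ admits a strong Deuring embedding relative to $\kappa_Q$ into some algebra $C$ over $R$ if and only if $A$ admits a $Q$-normal structure with zero Teichmüller class.
   Context: $\mathrm U(\cdot)$ denotes groups of units; $\mathrm U(S)$ is a $Q$-module via $\kappa_Q$. A central $S$-algebra $A$ is one with center $S$; $\mathrm{Out}(A)$ is the group of ring automorphisms of $A$ modulo inner ones, with $\mathrm{res}\colon\mathrm{Out}(A)\to\mathrm{Aut}(S)$ restriction to the center. A $Q$-normal structure on $A$ is a homomorphism $\sigma\colon Q\to\mathrm{Out}(A)$ with $\mathrm{res}\circ\sigma=\kappa_Q$. Its Teichmüller class is the class in $\mathrm H^3(Q,\mathrm U(S))$ of the crossed 2-fold extension $0\to\mathrm U(S)\to\mathrm U(A)\to B^\sigma\to Q\to1$, $B^\sigma=\mathrm{Aut}(A)\times_{\mathrm{Out}(A)}Q$ (fiber product via $\sigma$), $\mathrm U(A)\to B^\sigma$ sending $u$ to (conjugation by $u$, $1$), $B^\sigma$ acting on $\mathrm U(A)$ via $\mathrm{Aut}(A)$;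 here $\mathrm H^3(Q,M)$ is identified in the standard way with the group of classes of crossed 2-fold extensions $0\to M\to C\to\Gamma\to Q\to 1$ (exact sequences with $C\to\Gamma$ a crossed module) modulo the equivalence generated by morphisms that are the identity on $M$ and $Q$. Let $C$ be an $R$-algebra containing $A$ as a subalgebra. $N^{\mathrm U(C)}(A)$ is the group of $u\in\mathrm U(C)$ with $uAu^{-1}=A$; it contains $\mathrm U(A)$ as a normal subgroup. Conjugation gives $\eta\colon N^{\mathrm U(C)}(A)\to\mathrm{Aut}(A)$, $\eta(u)(a)=uau^{-1}$, inducing $\eta_\sharp\colon N^{\mathrm U(C)}(A)/\mathrm U(A)\to\mathrm{Out}(A)$, and $\eta_\flat=\mathrm{res}\circ\eta_\sharp$. A strong Deuring embedding of $A$ into $C$ relative to $\kappa_Q$ is the embedding $A\subseteq C$ together with a homomorphism $\chi\colon Q\to N^{\mathrm U(C)}(A)/\mathrm U(A)$ with $\eta_\flat\circ\chi=\kappa_Q$; it induces the $Q$-normal structure $\eta_\sharp\circ\chi$ on $A$. *)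

(* Defs.v *)
From HB Require Import structures.
From mathcomp Require Import all_boot all_algebra.
Set Implicit Arguments. Unset Strict Implicit. Unset Printing Implicit Defensive.
Import GRing.Theory.
Local Open Scope ring_scope.

Record group := Group {
  gT :> Type;
  gmul : gT -> gT -> gT;
  gone : gT;
  ginv : gT -> gT;
  gmulA : forall x y z, gmul x (gmul y z) = gmul (gmul x y) z;
  gmul1g : forall x, gmul gone x = x;
  gmulVg : forall x, gmul (ginv x) x = gone }.

(* A group presented as a subset [smem] of an ambient type with operations. *)
Record sgroup := SGroup {
  sT : Type;
  smem : sT -> Prop;
  smul : sT -> sT -> sT;
  sone : sT;
  sinv : sT -> sT }.
Arguments smem : clear implicits.
Arguments smul : clear implicits.
Arguments sinv : clear implicits.

Definition is_sgroup (G : sgroup) : Prop :=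
  smem G (sone G) /\
  (forall x y, smem G x -> smem G y -> smem G (smul G x y)) /\
  (forall x, smem G x -> smem G (sinv G x)) /\
  (forall x y z, smem G x -> smem G y -> smem G z ->
     smul G x (smul G y z) = smul G (smul G x y) z) /\
  (forall x, smem G x -> smul G (sone G) x = x /\ smul G x (sone G) = x) /\
  (forall x, smem G x -> smul G (sinv G x) x = sone G /\ smul G x (sinv G x) = sone G).

Definition sg_of_group (Q : group) : sgroup :=
  @SGroup (gT Q) (fun _ => True) (@gmul Q) (gone Q) (@ginv Q).

Definition is_shom (G H : sgroup) (f : sT G -> sT H) : Prop :=
  (forall x, smem G x -> smem H (f x)) /\
  (forall x y, smem G x -> smem G y -> f (smul G x y) = smul H (f x) (f y)).

(* ---------- crossed 2-fold extensions 0 -> M -> C -> Gamma -> Q -> 1 ---------- *)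
Record xext (M Q : sgroup) := XExt {
  xC : sgroup;
  xG : sgroup;
  xi : sT M -> sT xC;
  xd : sT xC -> sT xG;
  xp : sT xG -> sT Q;
  xact : sT xG -> sT xC -> sT xC }.
Arguments xC {M Q} x.
Arguments xG {M Q} x.
Arguments xi {M Q} x _.
Arguments xd {M Q} x _.
Arguments xp {M Q} x _.
Arguments xact {M Q} x _ _.

Section XExt.
Variables (M Q : sgroup) (mact : sT Q -> sT M -> sT M).

Definition is_xext (X : xext M Q) : Prop :=
  let C := xC X in let G := xG X in
  is_sgroup C /\ is_sgroup G /\
  is_shom (xi X) /\ is_shom (xd X) /\ is_shom (xp X) /\
  (forall g c, smem G g -> smem C c -> smem C (xact X g c)) /\
  (forall g c c', smem G g -> smem C c -> smem C c' ->
     xact X g (smul C c c') = smul C (xact X g c) (xact X g c')) /\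
  (forall g g' c, smem G g -> smem G g' -> smem C c ->
     xact X (smul G g g') c = xact X g (xact X g' c)) /\
  (forall c, smem C c -> xact X (sone G) c = c) /\
  (forall g c, smem G g -> smem C c ->
     xd X (xact X g c) = smul G (smul G g (xd X c)) (sinv G g)) /\
  (forall c c', smem C c -> smem C c' ->
     xact X (xd X c) c' = smul C (smul C c c') (sinv C c)) /\
  (forall m m', smem M m -> smem M m' -> xi X m = xi X m' -> m = m') /\
  (forall c, smem C c -> (xd X c = sone G <-> exists2 m, smem M m & c = xi X m)) /\
  (forall g, smem G g -> (xp X g = sone Q <-> exists2 c, smem C c & g = xd X c)) /\
  (forall q, smem Q q -> exists2 g, smem G g & xp X g = q) /\
  (forall g m, smem G g -> smem M m -> xi X (mact (xp X g) m) = xact X g (xi X m)).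

Definition xmor (X Y : xext M Q) : Prop :=
  exists (f1 : sT (xC X) -> sT (xC Y)) (f2 : sT (xG X) -> sT (xG Y)),
    is_shom f1 /\ is_shom f2 /\
    (forall m, smem M m -> f1 (xi X m) = xi Y m) /\
    (forall c, smem (xC X) c -> xd Y (f1 c) = f2 (xd X c)) /\
    (forall g, smem (xG X) g -> xp Y (f2 g) = xp X g) /\
    (forall g c, smem (xG X) g -> smem (xC X) c ->
       f1 (xact X g c) = xact Y (f2 g) (f1 c)).

Inductive xequiv : xext M Q -> xext M Q -> Prop :=
| xequiv_refl X : xequiv X X
| xequiv_mor X Y : is_xext X -> is_xext Y -> xmor X Y -> xequiv X Y
| xequiv_sym X Y : xequiv X Y -> xequiv Y X
| xequiv_trans X Y Z : xequiv X Y -> xequiv Y Z -> xequiv X Z.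

Definition trivial_xext : xext M Q :=
  @XExt M Q M Q id (fun _ => sone Q) id mact.

Definition xclass_zero (X : xext M Q) : Prop := xequiv X trivial_xext.
End XExt.

Definition is_rhom (R1 R2 : pzRingType) (f : R1 -> R2) : Prop :=
  f 1 = 1 /\ (forall x y, f (x + y) = f x + f y) /\ (forall x y, f (x * y) = f x * f y).

(* unit group U(R), units represented as pairs (u, u^-1) *)
Definition units_sg (R : pzRingType) : sgroup :=
  @SGroup (R * R) (fun p => p.1 * p.2 = 1 /\ p.2 * p.1 = 1)
    (fun p q => (p.1 * q.1, q.2 * p.2)) (1, 1) (fun p => (p.2, p.1)).

(* Aut(A): ring automorphisms, represented as pairs (alpha, alpha^-1) *)
Definition is_aut (A : pzRingType) (a : (A -> A) * (A -> A)) : Prop :=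
  is_rhom a.1 /\ cancel a.1 a.2 /\ cancel a.2 a.1.

Definition is_inner (A : pzRingType) (a : (A -> A) * (A -> A)) : Prop :=
  exists2 u, smem (units_sg A) u & forall x, a.1 x = u.1 * x * u.2.

(* P is an element of Out(A) = Aut(A)/Inn(A), i.e. a coset of Inn(A) *)
Definition out_class (A : pzRingType) (P : (A -> A) * (A -> A) -> Prop) : Prop :=
  exists a0, is_aut a0 /\
    forall b, P b <-> (is_aut b /\ is_inner (b.1 \o a0.2, a0.1 \o b.2)).

Section Rings.
Variables (S : comPzRingType) (Q : group) (kappa : Q -> S -> S).

Definition is_ring_action : Prop :=
  (forall q, is_rhom (kappa q) /\ bijective (kappa q)) /\
  (forall q q' s, kappa (gmul q q') s = kappa q (kappa q' s)).

Variables (A : pzRingType) (iota : S -> A).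

Definition is_central_alg : Prop :=
  is_rhom iota /\ injective iota /\
  (forall a : A, (forall b, a * b = b * a) <-> exists s, a = iota s).

(* sigma : Q -> Out(A) (each sigma q a coset of Inn(A)) is a Q-normal structure *)
Definition is_Qnormal (sigma : Q -> (A -> A) * (A -> A) -> Prop) : Prop :=
  (forall q, out_class (sigma q)) /\
  (forall q q' a b, sigma q a -> sigma q' b ->
     sigma (gmul q q') (a.1 \o b.1, b.2 \o a.2)) /\
  (forall q a s, sigma q a -> a.1 (iota s) = iota (kappa q s)).

Definition units_mact (q : Q) (m : S * S) : S * S := (kappa q m.1, kappa q m.2).

Definition Bsig_sg (sigma : Q -> (A -> A) * (A -> A) -> Prop) : sgroup :=
  @SGroup (((A -> A) * (A -> A)) * gT Q)
    (fun x => is_aut x.1 /\ sigma x.2 x.1)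
    (fun x y => ((x.1.1 \o y.1.1, y.1.2 \o x.1.2), gmul x.2 y.2))
    ((@id A, @id A), gone Q)
    (fun x => ((x.1.2, x.1.1), ginv x.2)).

Definition conj_aut (u : A * A) : (A -> A) * (A -> A) :=
  (fun x => u.1 * x * u.2, fun x => u.2 * x * u.1).

Definition teich_xext (sigma : Q -> (A -> A) * (A -> A) -> Prop)
  : xext (units_sg S) (sg_of_group Q) :=
  @XExt (units_sg S) (sg_of_group Q) (units_sg A) (Bsig_sg sigma)
    (fun m => (iota m.1, iota m.2))
    (fun u => (conj_aut u, gone Q))
    (fun x => x.2)
    (fun x u => (x.1.1 u.1, x.1.1 u.2)).

(* the Teichmueller class of (A, sigma) in H^3(Q, U(S)) is zero *)
Definition teich_zero (sigma : Q -> (A -> A) * (A -> A) -> Prop) : Prop :=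
  @xclass_zero (units_sg S) (sg_of_group Q) units_mact (teich_xext sigma).

Section Deuring.
Variables (C : pzRingType) (j : A -> C).

Definition in_normalizer (n : C * C) : Prop :=
  smem (units_sg C) n /\
  (forall a, exists b, n.1 * j a * n.2 = j b) /\
  (forall b, exists a, n.1 * j a * n.2 = j b).

(* P is an element of N^{U(C)}(A)/U(A), i.e. a coset of U(A) *)
Definition NU_class (P : C * C -> Prop) : Prop :=
  exists n0, in_normalizer n0 /\
    forall n, P n <-> (in_normalizer n /\
      exists2 a, smem (units_sg A) a & n = (n0.1 * j a.1, j a.2 * n0.2)).

(* (C, chi) is a strong Deuring embedding of A relative to kappa, where C is an
   algebra over R = S^Q containing A as an R-subalgebra via j *)
Definition is_strong_deuring (chi : Q -> C * C -> Prop) : Prop :=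
  is_rhom j /\ injective j /\
  (forall s, (forall q, kappa q s = s) -> forall c, j (iota s) * c = c * j (iota s)) /\
  (forall q, NU_class (chi q)) /\
  (forall q q' n n', chi q n -> chi q' n' ->
     chi (gmul q q') (n.1 * n'.1, n'.2 * n.2)) /\
  (forall q n s, chi q n -> n.1 * j (iota s) * n.2 = j (iota (kappa q s))).

Definition induces_normal (chi : Q -> C * C -> Prop)
  (sigma : Q -> (A -> A) * (A -> A) -> Prop) : Prop :=
  forall q n, chi q n ->
    exists2 a, sigma q a & forall x, j (a.1 x) = n.1 * j x * n.2.
End Deuring.
End Rings.

(* Main.v *)
From HB Require Import structures.
Require Import Defs.
From mathcomp Require Import all_boot all_algebra boolp.
From Stdlib Require Import FunctionalExtensionality IndefiniteDescription.
Set Implicit Arguments. Unset Strict Implicit. Unset Printing Implicit Defensive.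
Import GRing.Theory.
Local Open Scope ring_scope.

(** A crossed 2-fold extension [M -> C -> Gamma -> Q] has zero class iff it carries a
    factor set: a section [g] of [Gamma -> Q] and a map [c : Q x Q -> C] with
    [g q g r = d (c q r) g (q r)] satisfying the cocycle identity.  This property passes
    along morphisms in both directions and holds for the trivial extension; conversely a
    factor set defines a group extension [E] of [Q] by [C] mapping to [Gamma], and
    [M -> M x C -> E -> Q] maps both to the given extension and to the trivial one.

    For the Teichmueller class, a factor set consists of automorphisms [alpha q] in
    [sigma q] and units [c q r] of [A].  From a strong Deuring embedding it is read off by
    choosing representatives of the cosets [chi q].  Conversely, the crossed product of [A]
    and [Q] acts on the functions [Q -> A], and the ring of [S^Q]-linear endomorphisms of
    these functions serves as the algebra [C]; no finite supports are needed. *)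

(** * Calculus in groups given as subsets of a type, and their homomorphisms *)

Section SgroupTheory.
Variables (G : sgroup) (hG : is_sgroup G).
Local Notation "x ** y" := (smul G x y) (at level 40, left associativity).
Local Notation "x ^i" := (sinv G x) (at level 3).

Lemma sg1 : smem G (sone G). Proof. by case: hG. Qed.
Lemma sgM x y : smem G x -> smem G y -> smem G (x ** y).
Proof. by case: hG => _ [h _]; apply: h. Qed.
Lemma sgV x : smem G x -> smem G (x^i).
Proof. by case: hG => _ [_ [h _]]; apply: h. Qed.
Lemma sgA x y z : smem G x -> smem G y -> smem G z -> x ** y ** z = x ** (y ** z).
Proof. by case: hG => _ [_ [_ [h _]]] *; rewrite h. Qed.
Lemma sg1l x : smem G x -> sone G ** x = x.
Proof. by case: hG => _ [_ [_ [_ [h _]]]] /h []. Qed.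
Lemma sg1r x : smem G x -> x ** sone G = x.
Proof. by case: hG => _ [_ [_ [_ [h _]]]] /h []. Qed.
Lemma sgVl x : smem G x -> x^i ** x = sone G.
Proof. by case: hG => _ [_ [_ [_ [_ h]]]] /h []. Qed.
Lemma sgVr x : smem G x -> x ** x^i = sone G.
Proof. by case: hG => _ [_ [_ [_ [_ h]]]] /h []. Qed.

Lemma sgVK x y : smem G x -> smem G y -> x^i ** (x ** y) = y.
Proof. by move=> hx hy; rewrite -sgA ?sgVl ?sg1l //; apply: sgV. Qed.
Lemma sgKV x y : smem G x -> smem G y -> x ** (x^i ** y) = y.
Proof. by move=> hx hy; rewrite -sgA ?sgVr ?sg1l //; apply: sgV. Qed.
Lemma sgIl x y z : smem G x -> smem G y -> smem G z -> x ** y = x ** z -> y = z.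
Proof. by move=> hx hy hz e; rewrite -(sgVK hx hy) e sgVK. Qed.
Lemma sgIr x y z : smem G x -> smem G y -> smem G z -> y ** x = z ** x -> y = z.
Proof.
move=> hx hy hz e; have hx' := sgV hx.
by rewrite -(sg1r hy) -(sgVr hx) -sgA // e sgA // sgVr // sg1r.
Qed.
Lemma sgVM x y : smem G x -> smem G y -> (x ** y)^i = y^i ** x^i.
Proof.
move=> hx hy; have hx' := sgV hx; have hy' := sgV hy; have hxy := sgM hx hy.
apply: (@sgIl (x ** y)); [by []|exact: sgV|exact: sgM|].
by rewrite sgVr // sgA ?sgKV ?sgVr //; apply: sgM.
Qed.
Lemma sgVV x : smem G x -> (x^i)^i = x.
Proof.
move=> hx; have hx' := sgV hx.
by apply: (@sgIl (x^i)) => //; [exact: sgV|rewrite sgVr ?sgVl].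
Qed.
Lemma sgV1 : (sone G)^i = sone G.
Proof. by rewrite -{2}(sgVl sg1) sg1r //; apply/sgV/sg1. Qed.
Lemma sg_idem x : smem G x -> x ** x = x -> x = sone G.
Proof. by move=> hx e; apply: (@sgIl x) => //; [exact: sg1|rewrite sg1r]. Qed.

End SgroupTheory.

(** A left unit and left inverses suffice: inserting [1 = (x^-1)^-1 x^-1] in front of [x x^-1] and
    cancelling [x^-1 x] leaves [(x^-1)^-1 x^-1 = 1], and right neutrality follows. *)
Lemma left_sgroup (G : sgroup) :
  smem G (sone G) ->
  (forall x y, smem G x -> smem G y -> smem G (smul G x y)) ->
  (forall x, smem G x -> smem G (sinv G x)) ->
  (forall x y z, smem G x -> smem G y -> smem G z ->
     smul G x (smul G y z) = smul G (smul G x y) z) ->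
  (forall x, smem G x -> smul G (sone G) x = x) ->
  (forall x, smem G x -> smul G (sinv G x) x = sone G) -> is_sgroup G.
Proof.
move=> h1 hM hV hA h1l hVl.
have hVr x : smem G x -> smul G x (sinv G x) = sone G.
  move=> hx; have hx' := hV _ hx; have hx'' := hV _ hx'.
  rewrite -(h1l (smul G x _)); last exact: hM.
  rewrite -{1}(hVl _ hx') -hA //; last exact: hM.
  by rewrite (hA _ x) // hVl // h1l // hVl.
split=> //; do 3![split=> //]; split=> x hx; last by split; auto.
by split; [auto|rewrite -(hVl x hx) hA ?hVr ?h1l //; auto].
Qed.

Lemma sg_of_groupP (Q : group) : is_sgroup (sg_of_group Q).
Proof.
apply: left_sgroup => //= *; [exact: gmulA|exact: gmul1g|exact: gmulVg].
Qed.

Lemma gmulg1 (Q : group) (q : Q) : gmul q (gone Q) = q.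
Proof. exact: (sg1r (sg_of_groupP Q) (x := q) I). Qed.
Lemma gmulgV (Q : group) (q : Q) : gmul q (ginv q) = gone Q.
Proof. exact: (sgVr (sg_of_groupP Q) (x := q) I). Qed.

Section ShomTheory.
Variables (G H : sgroup) (f : sT G -> sT H).
Hypotheses (hG : is_sgroup G) (hH : is_sgroup H) (hf : is_shom f).

Lemma shom_mem x : smem G x -> smem H (f x).
Proof. by case: hf => h _; apply: h. Qed.
Lemma shomM x y : smem G x -> smem G y -> f (smul G x y) = smul H (f x) (f y).
Proof. by case: hf => _ h; apply: h. Qed.
Lemma shom1 : f (sone G) = sone H.
Proof.
have h1 := sg1 hG; apply: sg_idem => //; first exact: shom_mem.
by rewrite -shomM // sg1l.
Qed.
Lemma shomV x : smem G x -> f (sinv G x) = sinv H (f x).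
Proof.
move=> hx; have hx' := sgV hG hx; have hfx := shom_mem hx.
apply: (sgIl hH hfx); [exact: shom_mem|exact: sgV|].
by rewrite -shomM // !sgVr // shom1.
Qed.
End ShomTheory.

(** * Factor sets, and the rules of computation in one crossed 2-fold extension *)

Section FactorSets.
Variables (M : sgroup) (Q : group).
Variable (mact : sT (sg_of_group Q) -> sT M -> sT M).
Local Notation SQ := (sg_of_group Q).

(** Factor sets are not normalized: [c 1 1] may differ from the unit, which is why its inverse
    enters the extension built from a factor set below. *)
Definition is_factor_set (X : xext M SQ) (g : Q -> sT (xG X))
    (c : Q -> Q -> sT (xC X)) : Prop :=
  (forall q, smem (xG X) (g q)) /\ (forall q, xp X (g q) = q) /\
  (forall q r, smem (xC X) (c q r)) /\
  (forall q r, smul (xG X) (g q) (g r) = smul (xG X) (xd X (c q r)) (g (gmul q r))) /\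
  (forall q r s, smul (xC X) (c q r) (c (gmul q r) s) =
     smul (xC X) (xact X (g q) (c r s)) (c q (gmul r s))).

Definition has_factor_set (X : xext M SQ) : Prop :=
  exists g c, @is_factor_set X g c.

Section OneExtension.
Variables (X : xext M SQ) (hX : is_xext mact X).
Local Notation C := (xC X).
Local Notation G := (xG X).
Local Notation "x ** y" := (smul C x y) (at level 40, left associativity).
Local Notation "x ^i" := (sinv C x) (at level 3).
Local Notation "g ## h" := (smul G g h) (at level 40, left associativity).
Local Notation d := (xd X).
Local Notation act := (xact X).

Lemma xCP : is_sgroup C. Proof. by case: hX. Qed.
Lemma xGP : is_sgroup G. Proof. by case: hX => _ []. Qed.
Lemma xiP : is_shom (xi X). Proof. by case: hX; tauto. Qed.
Lemma xdP : is_shom (xd X). Proof. by case: hX; tauto. Qed.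
Lemma xpP : is_shom (xp X). Proof. by case: hX; tauto. Qed.
Lemma xact_mem g c : smem G g -> smem C c -> smem C (act g c).
Proof. by move: g c; case: hX; tauto. Qed.
Lemma xactM g c c' : smem G g -> smem C c -> smem C c' ->
  act g (c ** c') = act g c ** act g c'.
Proof. by move: g c c'; case: hX; tauto. Qed.
Lemma xact_comp g g' c : smem G g -> smem G g' -> smem C c ->
  act (g ## g') c = act g (act g' c).
Proof. by move: g g' c; case: hX; tauto. Qed.
Lemma xact1 c : smem C c -> act (sone G) c = c.
Proof. by move: c; case: hX; tauto. Qed.
Lemma xd_act g c : smem G g -> smem C c -> d (act g c) = g ## d c ## sinv G g.
Proof. by move: g c; case: hX; tauto. Qed.
Lemma xpeiffer c c' : smem C c -> smem C c' -> act (d c) c' = c ** c' ** c^i.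
Proof. by move: c c'; case: hX; tauto. Qed.
Lemma xi_inj m m' : smem M m -> smem M m' -> xi X m = xi X m' -> m = m'.
Proof. by move: m m'; case: hX; tauto. Qed.
Lemma xkerd c : smem C c -> (d c = sone G <-> exists2 m, smem M m & c = xi X m).
Proof. by move: c; case: hX; tauto. Qed.
Lemma xkerp g : smem G g -> (xp X g = gone Q <-> exists2 c, smem C c & g = d c).
Proof. by move: g; case: hX; tauto. Qed.
Lemma xp_surj q : exists2 g, smem G g & xp X g = q.
Proof.
have h : forall q, True -> exists2 g, smem G g & xp X g = q by case: hX; tauto.
exact: h.
Qed.
Lemma xi_act g m : smem G g -> smem M m -> xi X (mact (xp X g) m) = act g (xi X m).
Proof. by move: g m; case: hX; tauto. Qed.

Lemma xact_one g : smem G g -> act g (sone C) = sone C.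
Proof.
move=> hg; have h1 := sg1 xCP; apply: (sg_idem xCP); first exact: xact_mem.
by rewrite -xactM // (sg1l xCP).
Qed.
Lemma xactV g c : smem G g -> smem C c -> act g (c^i) = (act g c)^i.
Proof.
move=> hg hc; have hc' := sgV xCP hc; have ha := xact_mem hg hc.
apply: (sgIl xCP ha); [exact: xact_mem|exact: (sgV xCP)|].
by rewrite -xactM // !(sgVr xCP) // xact_one.
Qed.
Lemma xd_mem c : smem C c -> smem G (d c).
Proof. exact: (shom_mem xdP). Qed.
Lemma xi_mem m : smem M m -> smem C (xi X m).
Proof. exact: (shom_mem xiP). Qed.
Lemma xdM c c' : smem C c -> smem C c' -> d (c ** c') = d c ## d c'.
Proof. exact: (shomM xdP). Qed.
Lemma xd1 : d (sone C) = sone G.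
Proof. exact: (shom1 xCP xGP xdP). Qed.
Lemma xdV c : smem C c -> d (c^i) = sinv G (d c).
Proof. exact: (shomV xCP xGP xdP). Qed.
Lemma xpd c : smem C c -> xp X (d c) = gone Q.
Proof. by move=> hc; apply/(xkerp (xd_mem hc)); exists c. Qed.
Lemma xdi m : smem M m -> d (xi X m) = sone G.
Proof. by move=> hm; apply/(xkerd (xi_mem hm)); exists m. Qed.
(** Since [d (xi m) = 1] acts trivially, the Peiffer identity says that conjugation by [xi m] is
    trivial. *)
Lemma xi_central m c : smem M m -> smem C c -> xi X m ** c = c ** xi X m.
Proof.
move=> hm hc; have hi := xi_mem hm; have := xpeiffer hi hc.
rewrite xdi // xact1 // => e; rewrite {2}e (sgA xCP) ?(sgVl xCP) ?(sg1r xCP) //;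
  by [exact: (sgM xCP) | exact: (sgV xCP)].
Qed.
(** The Peiffer identity cleared of inverses, convenient for moving elements inside words;
    [xd_act_swap] does the same for the equivariance of [d]. *)
Lemma xact_d_swap c x : smem C c -> smem C x -> act (d c) x ** c = c ** x.
Proof.
move=> hc hx; have hc' := sgV xCP hc; have hcx := sgM xCP hc hx.
by rewrite xpeiffer // (sgA xCP) // (sgVl xCP) // (sg1r xCP).
Qed.
Lemma xd_act_swap g c : smem G g -> smem C c -> d (act g c) ## g = g ## d c.
Proof.
move=> hg hc; have hg' := sgV xGP hg; have hdc := xd_mem hc.
have hgc := sgM xGP hg hdc.
by rewrite xd_act // (sgA xGP) // (sgVl xGP) // (sg1r xGP).
Qed.
End OneExtension.

End FactorSets.

(* Automation: membership conditions and normal forms of words in a crossed extension *)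
Create HintDb xmem.
Hint Resolve sg1 sgM sgV shom_mem xCP xGP xiP xdP xpP xact_mem xd_mem xi_mem : xmem.
Ltac mem := solve [typeclasses eauto with xmem].
Ltac rw l := rewrite l; [|mem..].

(** Normalizes words in both groups of the extension: products associate to the right, inverses
    cancel, and [act] and [d] are distributed over products. The Peiffer and equivariance identities
    are left to explicit rewriting. *)
Ltac xsimp hX :=
  let hC := constr:(xCP hX) in let hG := constr:(xGP hX) in
  repeat first
  [ rw (sgA hC) | rw (sgVK hC) | rw (sgKV hC) | rw (sgVl hC) | rw (sgVr hC)
  | rw (sg1l hC) | rw (sg1r hC) | rw (sgVM hC) | rw (sgVV hC) | rewrite (sgV1 hC)
  | rw (xactM hX) | rw (xactV hX) | rw (xact_one hX) | rw (xact1 hX)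
  | rw (sgA hG) | rw (sgVK hG) | rw (sgKV hG) | rw (sgVl hG) | rw (sgVr hG)
  | rw (sg1l hG) | rw (sg1r hG) | rw (sgVM hG) | rw (sgVV hG) | rewrite (sgV1 hG)
  | rw (xdM hX) | rw (xdV hX) | rewrite (xd1 hX) | rw (xact_comp hX) ].

(** * Existence of a factor set is invariant under equivalence of extensions *)

Section FactorSetTheory.
Variables (M : sgroup) (Q : group).
Variable (mact : sT (sg_of_group Q) -> sT M -> sT M).
Local Notation SQ := (sg_of_group Q).

Section Change.
Variables (X : xext M SQ) (hX : is_xext mact X).
Local Notation C := (xC X).
Local Notation G := (xG X).
Local Notation "x ** y" := (smul C x y) (at level 40, left associativity).
Local Notation "x ^i" := (sinv C x) (at level 3).
Local Notation "g ## h" := (smul G g h) (at level 40, left associativity).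
Local Notation d := (xd X).
Local Notation act := (xact X).
Let hC := xCP hX.
Let hG := xGP hX.

Variables (g : Q -> sT G) (c : Q -> Q -> sT C).
Hypothesis gc : is_factor_set g c.

Lemma fs_gmem q : smem G (g q). Proof. by case: gc. Qed.
Lemma fs_sect q : xp X (g q) = q. Proof. by case: gc => _ []. Qed.
Lemma fs_cmem q r : smem C (c q r). Proof. by case: gc => _ [_ []]. Qed.
Lemma fs_mul q r : g q ## g r = d (c q r) ## g (gmul q r).
Proof. by case: gc => _ [_ [_ []]]. Qed.
Lemma fs_cocycle q r s :
  c q r ** c (gmul q r) s = act (g q) (c r s) ** c q (gmul r s).
Proof. by case: gc => _ [_ [_ [_]]]. Qed.
Hint Resolve fs_gmem fs_cmem : xmem.

(** By the Peiffer identity the left side is [d (c q r)] applied to [act (g (q r)) x], followed by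
    [c q r]; and [d (c q r) ## g (q r)] is [g q ## g r]. *)
Lemma fs_act_swap q r x : smem C x ->
  c q r ** act (g (gmul q r)) x = act (g q) (act (g r) x) ** c q r.
Proof.
move=> hx; rewrite -(xact_d_swap hX); [|mem..].
by rewrite -!(xact_comp hX) ?fs_mul //; mem.
Qed.

(** The nonabelian coboundary formula: moving the section within its fibres by [e] forces this
    change of [c]. *)
Lemma factor_set_change (e : Q -> sT C) : (forall q, smem C (e q)) ->
  is_factor_set (fun q => d (e q) ## g q)
    (fun q r => e q ** act (g q) (e r) ** c q r ** (e (gmul q r))^i).
Proof.
move=> he; split; [|split; [|split; [|split]]].
- move=> q; mem.
- move=> q; rewrite (shomM (xpP hX)); [|mem..]; rewrite (xpd hX) // fs_sect.
  exact: gmul1g.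
- move=> q r; mem.
- move=> q r; have e1 : g q ## (d (e r) ## g r) = d (act (g q) (e r)) ## (g q ## g r).
    by rewrite -!(sgA hG) ?(xd_act_swap hX) //; mem.
  xsimp hX; by rewrite e1 fs_mul.
- move=> q r s.
  (* The core of the new cocycle identity: [fs_act_swap] carries the term in [e s] past [c q r],
     after which the old cocycle identity applies. *)
  have e1 : c q r ** (act (g (gmul q r)) (e s) **
        (c (gmul q r) s ** (e (gmul q (gmul r s)))^i)) =
      act (g q) (act (g r) (e s)) ** (act (g q) (c r s) **
        (c q (gmul r s) ** (e (gmul q (gmul r s)))^i)).
    rewrite -(sgA hC) ?fs_act_swap ?(sgA hC); try mem.
    by rewrite -(sgA hC (fs_cmem _ _)) ?fs_cocycle ?(sgA hC); try mem.
  rewrite -gmulA; xsimp hX; rewrite e1; repeat rw (xpeiffer hX).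
  by xsimp hX.
Qed.

End Change.

(** Multiplied on the right by [g (q r s)], both sides become [g q ## g r ## g s] by associativity.
    So the failure of the cocycle identity lies in the kernel of [d], that is, in [M]. *)
Lemma cocycle_defect (X : xext M SQ) (g : Q -> sT (xG X)) (c : Q -> Q -> sT (xC X)) :
  is_xext mact X -> (forall q, smem (xG X) (g q)) -> (forall q r, smem (xC X) (c q r)) ->
  (forall q r, smul (xG X) (g q) (g r) = smul (xG X) (xd X (c q r)) (g (gmul q r))) ->
  forall q r s, xd X (smul (xC X) (c q r) (c (gmul q r) s)) =
    xd X (smul (xC X) (xact X (g q) (c r s)) (c q (gmul r s))).
Proof.
move=> hX hg hc gM q r s; have hG := xGP hX.
have hq := hg q; have hr := hg r; have hs := hg s.
apply: (sgIr hG (hg (gmul (gmul q r) s))); [mem..|].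
rewrite !(xdM hX); [|mem..].
rewrite (sgA hG) -?gM; [|mem..].
rewrite -(sgA hG) -?gM; [|mem..].
rewrite (sgA hG) ?gM; [|mem..].
rewrite -(sgA hG) ?(xd_act_swap hX); [|mem..].
rewrite -?gmulA (sgA hG (xd_mem hX (xact_mem hX hq (hc r s)))) -?gM; [|mem..].
by rewrite -(sgA hG) ?(xd_act_swap hX) //; mem.
Qed.

Lemma xd_eqP (X : xext M SQ) x y : is_xext mact X -> smem (xC X) x -> smem (xC X) y ->
  xd X x = xd X y -> exists2 m, smem M m & y = smul (xC X) x (xi X m).
Proof.
move=> hX hx hy e; have hC := xCP hX.
have hz : smem (xC X) (smul (xC X) (sinv (xC X) x) y) by mem.
have [|m hm em] := (xkerd hX hz).1.
  by rewrite (xdM hX) ?(xdV hX) -?e ?(sgVl (xGP hX)) //; mem.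
by exists m => //; rewrite -em (sgKV hC).
Qed.

Lemma has_factor_set_push (X Y : xext M SQ) :
  is_xext mact X -> xmor X Y -> has_factor_set X -> has_factor_set Y.
Proof.
move=> hX [f1 [f2 [h1 [h2 [_ [fd [fp fact]]]]]]] [g [c [hg [gp [hc [gM cM]]]]]].
exists (fun q => f2 (g q)), (fun q r => f1 (c q r)).
split; [|split; [|split; [|split]]] => *.
- mem.
- by rewrite fp.
- mem.
- by rewrite fd // -!(shomM h2) ?gM //; mem.
- by rewrite -fact // -!(shomM h1) ?cM //; mem.
Qed.

(* Fibres of [d] are torsors under [M], so [f1] is a bijection between the fibres of [d_X]
   and those of [d_Y]: the factor set of [Y] lifts, and so does its cocycle identity. *)
Lemma has_factor_set_pull (X Y : xext M SQ) : is_xext mact X -> is_xext mact Y ->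
  xmor X Y -> has_factor_set Y -> has_factor_set X.
Proof.
move=> hX hY [f1 [f2 [h1 [h2 [fi [fd [fp fact]]]]]]] [g0 [c0 gc0]].
have hCX := xCP hX; have hCY := xCP hY; have hGX := xGP hX; have hGY := xGP hY.
have [g gP] : exists g : Q -> sT (xG X), forall q, smem (xG X) (g q) /\ xp X (g q) = q.
  apply: (functional_choice (fun q g => smem (xG X) g /\ xp X g = q)) => q.
  by have [g ? ?] := xp_surj hX q; exists g.
have hg q : smem (xG X) (g q) by case: (gP q).
have gp q : xp X (g q) = q by case: (gP q).
have hf2 q : smem (xG Y) (f2 (g q)) by mem.
have hg0 := fs_gmem gc0.
(* Both [f2 \o g] and [g0] are sections of [xp Y], so they differ by values of [xd Y]. Changing the
   given factor set by [e] yields one whose section is [f2 \o g]. *)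
have [e eP] : exists e : Q -> sT (xC Y), forall q, smem (xC Y) (e q) /\
    f2 (g q) = smul (xG Y) (xd Y (e q)) (g0 q).
  apply: (functional_choice (fun q x => smem (xC Y) x /\
    f2 (g q) = smul (xG Y) (xd Y x) (g0 q))) => q.
  have hz : smem (xG Y) (smul (xG Y) (f2 (g q)) (sinv (xG Y) (g0 q))) by mem.
  have [|x hx ex] := (xkerp hY hz).1.
    rewrite (shomM (xpP hY)) ?(shomV hGY (sg_of_groupP Q) (xpP hY)) //; [|mem].
    by rewrite fp // gp (fs_sect gc0); apply: (sgVr (sg_of_groupP Q)).
  exists x; split=> //.
  by rewrite -ex (sgA hGY) ?(sgVl hGY) ?(sg1r hGY) //; mem.
have he q : smem (xC Y) (e q) by case: (eP q).
have [g1 [c1 [gc1 f2E]]] : exists g1 c1, is_factor_set g1 c1 /\ forall q, g1 q = f2 (g q).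
  by do 2!eexists; split; [exact: (factor_set_change hY gc0 he)|move=> q; case: (eP q)].
have [_ [_ [hc1 [g1M c1M]]]] := gc1.
(* Any [x] with the required image under [xd X] is sent by [f1] into the fibre of [xd Y] through
   [c1 q r]; a factor [xi X m] then adjusts [x] so that the two agree. *)
have [c cP] : exists c : Q * Q -> sT (xC X), forall p, [/\ smem (xC X) (c p),
    smul (xG X) (g p.1) (g p.2) = smul (xG X) (xd X (c p)) (g (gmul p.1 p.2)) &
    f1 (c p) = c1 p.1 p.2].
  apply: (functional_choice (fun (p : Q * Q) x => [/\ smem (xC X) x,
    smul (xG X) (g p.1) (g p.2) = smul (xG X) (xd X x) (g (gmul p.1 p.2)) &
    f1 x = c1 p.1 p.2])) => -[q r] /=.
  have hqr := hg (gmul q r); have hq := hg q; have hr := hg r.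
  have hz : smem (xG X) (smul (xG X) (smul (xG X) (g q) (g r)) (sinv (xG X) (g (gmul q r)))).
    mem.
  have [|x hx ex] := (xkerp hX hz).1.
    rewrite !(shomM (xpP hX)) ?(shomV hGX (sg_of_groupP Q) (xpP hX)) //; [|mem..].
    by rewrite !gp; apply: (sgVr (sg_of_groupP Q)).
  have xE : smul (xG X) (g q) (g r) = smul (xG X) (xd X x) (g (gmul q r)).
    by rewrite -ex (sgA hGX) ?(sgVl hGX) ?(sg1r hGX) //; mem.
  have [||m hm em] := @xd_eqP Y (f1 x) (c1 q r) hY _ (hc1 q r); first by mem.
    apply: (sgIr hGY (hf2 (gmul q r))); [mem..|].
    rewrite fd // -(shomM h2) -?xE ?(shomM h2) //; [|mem].
    by rewrite -!f2E -g1M.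
  exists (smul (xC X) x (xi X m)); split; first by mem.
    by rewrite (xdM hX) ?(xdi hX) ?(sg1r hGX) //; mem.
  by rewrite (shomM h1) ?fi //; mem.
have hc q r : smem (xC X) (c (q, r)) by case: (cP (q, r)).
have gM q r : smul (xG X) (g q) (g r) = smul (xG X) (xd X (c (q, r))) (g (gmul q r)).
  by case: (cP (q, r)).
have f1c q r : f1 (c (q, r)) = c1 q r by case: (cP (q, r)).
exists g, (fun q r => c (q, r)); split=> //; do 3![split=> //] => q r s.
set lhs := smul _ _ _; set rhs := smul _ _ _.
have hl : smem (xC X) lhs by rewrite /lhs; mem.
have hr : smem (xC X) rhs by rewrite /rhs; mem.
have ed : xd X lhs = xd X rhs.
  exact: (@cocycle_defect X g (fun q r => c (q, r))).
have ef : f1 lhs = f1 rhs.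
  by rewrite !(shomM h1) ?fact ?f1c -?f2E ?c1M //; mem.
have [m hm em] := xd_eqP hX hl hr ed.
suff mE : xi X m = sone (xC X) by rewrite em mE (sg1r hCX).
(* [is_xext] states no group axioms for [M], so its neutral element is taken to be the preimage [m0]
   of the unit under [xi X]. It equals [m] because [f1] maps both sides of the cocycle identity to
   the same element. *)
have [m0 hm0 e0] := (xkerd hX (sg1 hCX)).1 (xd1 hX).
rewrite e0; congr (xi X _); apply: (xi_inj hY) => //.
rewrite -(fi m0) // -e0 (shom1 hCX hCY h1).
have hfl : smem (xC Y) (f1 lhs) by mem.
apply: (sgIl hCY hfl); [mem..|].
by rewrite (sg1r hCY) // -fi // -(shomM h1) -?em //; mem.
Qed.

Lemma has_factor_set_xequiv (X Y : xext M SQ) :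
  xequiv mact X Y -> (has_factor_set X <-> has_factor_set Y).
Proof.
elim=> // [X' Y' hX hY f|X' Y' _ [? ?]|X' Y' Z' _ [? ?] _ [? ?]].
- by split; [apply: (has_factor_set_push hX)|apply: has_factor_set_pull].
- by split.
- by split; auto.
Qed.

Lemma has_factor_set_trivial :
  is_xext mact (trivial_xext mact) -> has_factor_set (trivial_xext mact).
Proof.
move=> h; have hM : is_sgroup M := xCP h; have h1 := sg1 hM.
exists (fun q => q), (fun q r => sone M); do 4![split=> //] => /=.
- by move=> q r; rewrite gmul1g.
- by move=> q r s; have /= -> := xact_one h (g := q) I.
Qed.
End FactorSetTheory.

(** * A factor set makes the class of the extension zero *)

Section Splitting.
Variables (M : sgroup) (Q : group).
Variable (mact : sT (sg_of_group Q) -> sT M -> sT M).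
Local Notation SQ := (sg_of_group Q).
Variables (X : xext M SQ) (hX : is_xext mact X).
Hypothesis hT : is_xext mact (trivial_xext mact).
Local Notation C := (xC X).
Local Notation G := (xG X).
Local Notation "x ** y" := (smul C x y) (at level 40, left associativity).
Local Notation "x ^i" := (sinv C x) (at level 3).
Local Notation "g ## h" := (smul G g h) (at level 40, left associativity).
Local Notation d := (xd X).
Local Notation act := (xact X).
Let hC := xCP hX.
Let hG := xGP hX.
Let hM : is_sgroup M := xCP hT.

Variables (g : Q -> sT G) (c : Q -> Q -> sT C).
Hypothesis gc : is_factor_set g c.
Let hg : forall q, smem G (g q) := fs_gmem gc.
Let hc : forall q r, smem C (c q r) := fs_cmem gc.
Local Notation c11 := (c (gone Q) (gone Q)).

Lemma mact_mem q m : smem M m -> smem M (mact q m).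
Proof. exact: (@xact_mem _ _ _ _ hT q m I). Qed.
Hint Resolve mact_mem : xmem.

Lemma fs_g1 : g (gone Q) = d c11.
Proof.
by apply: (sgIr hG (hg (gone Q))); [mem..|rewrite (fs_mul gc) gmul1g].
Qed.
Lemma fs_act1 x : smem C x -> act (g (gone Q)) x = c11 ** x ** c11^i.
Proof. by move=> hx; rewrite fs_g1 (xpeiffer hX). Qed.
(** The cocycle identity at [(1, 1, q)], where [g 1 = d c11] acts as conjugation by [c11]; after
    cancellation only the claim remains. The next lemma uses [(q, 1, 1)]. *)
Lemma fs_c1l q : c (gone Q) q = c11.
Proof.
have := fs_cocycle gc (gone Q) (gone Q) q; rewrite !gmul1g fs_act1 // => e.
have {}e : c11 ** (c (gone Q) q) = c11 ** (c (gone Q) q ** (c11^i ** c (gone Q) q)).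
  by rewrite e; xsimp hX.
move/(sgIl hC): e => e.
have {}e := e (hc _ _) (hc _ _) ltac:(mem).
rewrite -{1}(sg1r hC (hc (gone Q) q)) in e; move/(sgIl hC): e => e.
have {}e := e (hc _ _) ltac:(mem) ltac:(mem).
by rewrite -(sg1r hC (hc (gone Q) (gone Q))) e; xsimp hX.
Qed.
Lemma fs_c1r q : c q (gone Q) = act (g q) c11.
Proof.
have := fs_cocycle gc q (gone Q) (gone Q); rewrite !gmulg1.
by apply: (sgIr hC); mem.
Qed.

(** Schreier's extension of [Q] by [C]: the pair [(x, q)] stands for [x u_q], where
    [u_q x = act (g q) x u_q] and [u_q u_r = c q r u_qr]. As [u_1 = c11], the unit is [(c11^-1, 1)];
    the inverse solves the equation for a left inverse. *)
Definition fs_ext : sgroup :=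
  @SGroup (sT C * Q) (fun e => smem C e.1)
    (fun e f => (e.1 ** act (g e.2) f.1 ** c e.2 f.2, gmul e.2 f.2))
    (c11^i, gone Q)
    (fun e => (c11^i ** (c (ginv e.2) e.2)^i ** (act (g (ginv e.2)) e.1)^i, ginv e.2)).

Lemma fs_extP : is_sgroup fs_ext.
Proof.
apply: left_sgroup => /=.
- mem.
- move=> [x q] [y r] /= hx hy; mem.
- move=> [x q] /= hx; mem.
- move=> [x q] [y r] [z s] /= hx hy hz; rewrite -gmulA; congr (_, _); xsimp hX.
  have -> : c q r ** (act (g (gmul q r)) z ** c (gmul q r) s) =
     act (g q) (act (g r) z) ** (c q r ** c (gmul q r) s).
    by rewrite -(sgA hC) ?(fs_act_swap hX gc) ?(sgA hC) //; mem.
  by rewrite (fs_cocycle gc).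
- move=> [x q] /= hx; rewrite gmul1g; congr (_, _).
  by rewrite fs_act1 // fs_c1l; xsimp hX.
- by move=> [x q] /= hx; rewrite gmulVg; congr (_, _); xsimp hX.
Qed.

Definition fs_proj (e : sT fs_ext) : sT G := d e.1 ## g e.2.

Lemma fs_projP : @is_shom fs_ext G fs_proj.
Proof.
rewrite /fs_proj; split=> [[x q] /= hx|[x q] [y r] /= hx hy]; first by mem.
have e1 : g q ## (d y ## g r) = d (act (g q) y) ## (d (c q r) ## g (gmul q r)).
  by rewrite -(fs_mul gc) -!(sgA hG) ?(xd_act_swap hX) //; mem.
by xsimp hX; rewrite e1.
Qed.

(** The element [x] of [C] written as [(x c11^-1) u_1]. *)
Definition fs_incl (x : sT C) : sT fs_ext := (x ** c11^i, gone Q).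

Lemma fs_proj_incl x : smem C x -> fs_proj (fs_incl x) = d x.
Proof. by move=> hx; rewrite /fs_proj /= fs_g1; xsimp hX. Qed.

Definition prod_sg (G1 G2 : sgroup) : sgroup :=
  @SGroup (sT G1 * sT G2) (fun p => smem G1 p.1 /\ smem G2 p.2)
    (fun p q => (smul G1 p.1 q.1, smul G2 p.2 q.2)) (sone G1, sone G2)
    (fun p => (sinv G1 p.1, sinv G2 p.2)).

Lemma prod_sgP (G1 G2 : sgroup) : is_sgroup G1 -> is_sgroup G2 -> is_sgroup (prod_sg G1 G2).
Proof.
move=> h1 h2; apply: left_sgroup => /=.
- by split; mem.
- by move=> x y [? ?] [? ?]; split; mem.
- by move=> x [? ?]; split; mem.
- by move=> x y z [? ?] [? ?] [? ?]; rewrite !(sgA h1) ?(sgA h2).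
- by move=> [x y] /= [? ?]; rewrite (sg1l h1) ?(sg1l h2).
- by move=> [x y] /= [? ?]; rewrite (sgVl h1) ?(sgVl h2).
Qed.

(** The common source of the two morphisms that link [X] to the trivial extension. The boundary map
    kills the factor [M] and embeds [C]; [fs_ext] acts on [M] through [Q] and on [C] through
    [fs_proj]. *)
Definition fs_xext : xext M SQ :=
  @XExt M SQ (prod_sg M C) fs_ext
    (fun m => (m, sone C)) (fun p => fs_incl p.2) (fun e => e.2)
    (fun e p => (mact e.2 p.1, act (fs_proj e) p.2)).

Lemma abelM m m' : smem M m -> smem M m' -> smul M m m' = smul M m' m.
Proof. by move=> hm hm'; have := xi_central hT (m := m) (c := m') hm hm'. Qed.

Lemma fs_xextP : is_xext mact fs_xext.
Proof.
have hE := fs_extP; have hp := fs_projP.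
have hpm := shom_mem hp.
have hi x : smem C x -> smem fs_ext (fs_incl x) by rewrite /=; mem.
split; first exact: prod_sgP.
split; first exact: fs_extP.
split; first by split=> [m|m m'] /= *; [split; mem|rewrite (sg1l hC)//; mem].
split.
  split=> [[m x] [/= _ hx]|[m x] [m' x'] [/= _ hx] [/= _ hx']]; first by mem.
  by rewrite /fs_incl gmul1g; congr (_, _); rewrite fs_act1; [|mem]; xsimp hX.
split; first by [].
split.
  move=> [y q] [m x] /= hy [hm hx].
  by split; [mem|apply: (xact_mem hX) => //; exact: hpm].
split.
  move=> [y q] [m x] [m' x'] /= hy [hm hx] [hm' hx'].
  congr (_, _); first exact: (@xactM _ _ _ _ hT q m m' I).
  by apply: (xactM hX) => //; exact: hpm.
split.
  move=> e e' [m x] /= he he' [hm hx].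
  congr (_, _); first exact: (@xact_comp _ _ _ _ hT e.2 e'.2 m I I).
  have -> := shomM hp he he'.
  by apply: (xact_comp hX) => //; exact: hpm.
split.
  move=> [m x] /= [hm hx]; congr (_, _); first exact: (@xact1 _ _ _ _ hT m).
  by rewrite (shom1 hE hG hp) (xact1 hX).
split.
  move=> e [m x] he [/= hm hx]; have hix := hi _ hx; have he' := sgV hE he.
  (* Equivariance of the boundary map is checked after multiplication by [e] on the right, which
     removes the inverse in [fs_ext]. *)
  have hei := sgM hE he hix; apply: (sgIr hE he).
  - by rewrite /=; apply: (sgM hC); [apply: (xact_mem hX)=> //; exact: hpm|mem].
  - exact: (sgM hE hei he').
  have -> := sgA hE hei he' he; rewrite (sgVl hE) // (sg1r hE) //.
  case: e he {hei he' hix hi hpm hp hE} => y q /= hy; rewrite /fs_incl /fs_proj /=.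
  rewrite gmul1g gmulg1; congr (_, _).
  rw (xact_comp hX); rw (xpeiffer hX); rw fs_act1; rewrite (fs_c1l q) (fs_c1r q).
  by xsimp hX.
split.
  move=> [m x] [m' x'] [/= hm hx] [/= hm' hx']; congr (_, _).
    have -> : smul M m m' = smul M m' m by exact: abelM.
    rewrite (sgA hM) ?(sgVr hM) ?(sg1r hM) //; [|mem].
    exact: (@xact1 _ _ _ _ hT m').
  by rewrite fs_proj_incl // (xpeiffer hX).
split; first by move=> m m' _ _ [].
split.
  move=> [m x] [/= hm hx]; split=> [[e]|[m' hm' [_ ->]]].
    exists m => //; congr (_, _); apply: (sgIr hC (x := c11^i)); [mem..|].
    by rewrite e (sg1l hC) //; mem.
  by rewrite /fs_incl (sg1l hC) //; mem.
split.
  move=> [y q] /= hy; split=> [-> | [p [_ hp2] [_ ->]] //].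
  exists (sone M, y ** c11) => /=; first by split; mem.
  by rewrite /fs_incl; congr (_, _); xsimp hX.
split; first by move=> q _; exists (sone C, q) => //=; mem.
by move=> e m he hm /=; rewrite (xact_one hX) //; exact: hpm.
Qed.

Lemma factor_set_xclass_zero : xclass_zero mact X.
Proof.
have hZ := fs_xextP.
apply: (@xequiv_trans _ _ _ _ fs_xext).
  apply: xequiv_sym; apply: xequiv_mor => //.
  (* The multiplication map from [M] times [C] to [C] is a homomorphism because the image of [xi] is
     central. *)
  exists (fun p => xi X p.1 ** p.2), fs_proj; split; [|split; [|split; [|split; [|split]]]].
  - split=> [[m x] [/= hm hx]|[m x] [m' x'] [/= hm hx] [/= hm' hx']]; first by mem.
    rewrite (shomM (xiP hX)) //; xsimp hX; congr (_ ** _).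
    by rewrite -!(sgA hC) ?(xi_central hX hm' hx) //; mem.
  - exact: fs_projP.
  - by move=> m hm /=; rewrite (sg1r hC) //; mem.
  - move=> [m x] [/= hm hx]; rewrite fs_proj_incl // (xdM hX) ?(xdi hX) ?(sg1l hG) //; mem.
  - move=> [y q] /= hy; rewrite /fs_proj (shomM (xpP hX)) //=; [|mem].
    by rewrite (xpd hX) // (fs_sect gc) gmul1g.
  - move=> [y q] [m x] hy [/= hm hx]; have hpe := shom_mem fs_projP hy.
    rewrite (xactM hX) //; [|mem]; rewrite -(xi_act hX) //.
    congr (xi X (mact _ _) ** _).
    rewrite /fs_proj (shomM (xpP hX)) //=; [|mem].
    by rewrite (xpd hX) // (fs_sect gc) gmul1g.
apply: xequiv_mor => //.
(* The projections onto [M] and [Q] give the morphism to the trivial extension. *)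
exists (fun p => p.1), (fun e => e.2); split; [|split; [|split; [|split; [|split]]]] => //.
by split=> [[m x] []|].
Qed.
End Splitting.

Lemma xclass_zeroP (M : sgroup) (Q : group)
    (mact : sT (sg_of_group Q) -> sT M -> sT M) (X : xext M (sg_of_group Q)) :
  is_xext mact X -> is_xext mact (trivial_xext mact) ->
  (xclass_zero mact X <-> has_factor_set X).
Proof.
move=> hX hT; split=> [/has_factor_set_xequiv h|[g [c gc]]].
  exact/h/(has_factor_set_trivial hT).
exact: (factor_set_xclass_zero hX hT gc).
Qed.

(** * Unit groups and automorphisms of rings *)

Lemma units_sgP (R : pzRingType) : is_sgroup (units_sg R).
Proof.
apply: left_sgroup => /=.
- by rewrite mulr1.
- move=> [x x'] [y y'] /= [xx' x'x] [yy' y'y].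
  by rewrite mulrA -(mulrA x) yy' mulr1 xx' mulrA -(mulrA y') x'x mulr1 y'y.
- by move=> x [].
- by move=> x y z *; rewrite !mulrA.
- by move=> [x x'] _ /=; rewrite mul1r mulr1.
- by move=> [x x'] /= [_ ->].
Qed.

Lemma unit_pair_eq (R : pzRingType) (u v : R * R) :
  smem (units_sg R) u -> smem (units_sg R) v -> u.1 = v.1 -> u = v.
Proof.
case: u v => [u u'] [v v'] /= [_ u'u] [vv' _] e; rewrite e; congr (_, _).
by rewrite -(mulr1 u') -vv' -e mulrA u'u mul1r.
Qed.

Section Automorphisms.
Variable A : pzRingType.
Implicit Types a b : (A -> A) * (A -> A).

Lemma aut_pair_eq a b : is_aut a -> is_aut b -> a.1 =1 b.1 -> a = b.
Proof.
case: a b => [a a'] [b b'] [/= _ [_ aK']] [/= _ [bK _]] e.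
congr (_, _); apply: functional_extensionality => x; first exact: e.
by rewrite -[LHS]bK -e aK'.
Qed.

Lemma autM a x y : is_aut a -> a.1 (x * y) = a.1 x * a.1 y.
Proof. by move=> [[_ [_ h]] _]. Qed.
Lemma autD a x y : is_aut a -> a.1 (x + y) = a.1 x + a.1 y.
Proof. by move=> [[_ [h _]] _]. Qed.
Lemma aut1 a : is_aut a -> a.1 1 = 1.
Proof. by move=> [[h _] _]. Qed.

Lemma id_is_aut : is_aut (@id A, @id A).
Proof. by []. Qed.
Lemma comp_is_aut a b : is_aut a -> is_aut b -> is_aut (a.1 \o b.1, b.2 \o a.2).
Proof.
move=> ha hb; split; last first.
  by split; apply: can_comp; case: ha => _ []; case: hb => _ [].
split; first by rewrite /= (aut1 hb) aut1.
by split=> x y; rewrite /= ?(autD _ _ hb) ?(autM _ _ hb) ?autD ?autM.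
Qed.
Lemma inv_is_aut a : is_aut a -> is_aut (a.2, a.1).
Proof.
move=> ha; have [_ [aK aK']] := ha; split=> //=.
by split=> [|/=]; [|split=> x y]; apply: (can_inj aK);
  rewrite /= ?(autD _ _ ha) ?(autM _ _ ha) ?aK' ?aut1.
Qed.
Lemma aut_unit a u : is_aut a -> smem (units_sg A) u ->
  smem (units_sg A) (a.1 u.1, a.1 u.2).
Proof. by move=> ha [h1 h2] /=; rewrite -!autM // h1 h2 aut1. Qed.
Lemma conj_is_aut u : smem (units_sg A) u -> is_aut (conj_aut u).
Proof.
case: u => u u' [/= uu' u'u]; split; last first.
  by split=> x /=; rewrite !mulrA ?uu' ?u'u mul1r -mulrA ?uu' ?u'u mulr1.
split; first by rewrite /= mulr1.
split=> x y /=; first by rewrite mulrDr mulrDl.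
by rewrite !mulrA -(mulrA (u * x) u') u'u mulr1.
Qed.
End Automorphisms.

(** * The Teichmüller class in terms of automorphisms and units *)

Section Teichmueller.
Variables (S : comPzRingType) (Q : group) (kappa : Q -> S -> S).
Hypothesis hkappa : is_ring_action kappa.
Variables (A : pzRingType) (iota : S -> A).
Hypothesis hA : is_central_alg iota.

(** The map [kappa 1] is idempotent and injective, hence the identity. *)
Lemma action_one s : kappa (gone Q) s = s.
Proof.
have [h hM] := hkappa; have [_ hb] := h (gone Q).
by apply: (bij_inj hb); rewrite -hM gmul1g.
Qed.

Local Notation is_units_xext := (@is_xext (units_sg S) (sg_of_group Q) (units_mact kappa)).

Lemma trivial_units_xextP :
  is_units_xext (@trivial_xext (units_sg S) (sg_of_group Q) (units_mact kappa)).
Proof.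
have hU := units_sgP S; have hQ := sg_of_groupP Q; have [hk hkM] := hkappa.
have kM q s t : kappa q (s * t) = kappa q s * kappa q t by case: (hk q) => -[_ []].
have k1 q : kappa q 1 = 1 by case: (hk q) => -[].
split=> //; split=> //; split=> //; split; first by split=> //= *; rewrite gmul1g.
split=> //.
split; first by move=> q [u u'] _ [/= h1 h2]; rewrite -!kM h1 h2 k1.
split; first by move=> q c c' _ _ _; rewrite /units_mact /= !kM.
split; first by move=> q q' c _ _ _; rewrite /units_mact /= !hkM.
split; first by move=> [c c'] _; rewrite /units_mact /= !action_one.
split; first by move=> q c _ _ /=; rewrite gmulg1 gmulgV.
split.
  move=> [c c'] [b b'] [/= h1 h2] _; rewrite /units_mact /= !action_one.
  by congr (_, _); [rewrite mulrAC h1 mul1r|rewrite mulrCA h1 mulr1].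
split=> //; split; first by move=> c hc; split=> // _; exists c.
split; first by move=> q _ /=; split=> [->|[]] //; exists (1, 1); rewrite //= mulr1.
by split=> // q _; exists q.
Qed.

Section Normal.
Variable sigma : Q -> (A -> A) * (A -> A) -> Prop.
Hypothesis hsigma : is_Qnormal kappa iota sigma.
Implicit Types a b : (A -> A) * (A -> A).

Lemma Qnormal_aut q a : sigma q a -> is_aut a.
Proof. by have [h _] := hsigma; have [a0 [_ h0]] := h q => /h0 []. Qed.

Lemma Qnormal_ex q : exists a, sigma q a.
Proof.
have [h _] := hsigma; have [a0 [ha0 h0]] := h q; exists a0; apply/h0; split=> //.
have [_ [_ aK']] := ha0; exists (1, 1); first by rewrite /= mulr1.
by move=> x /=; rewrite aK' mul1r mulr1.
Qed.

Lemma Qnormal_inner q a b : sigma q a -> sigma q b ->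
  exists2 u, smem (units_sg A) u & forall x, b.1 x = u.1 * a.1 x * u.2.
Proof.
have [h _] := hsigma; have [a0 [ha0 h0]] := h q.
move=> /h0 [_ [u hu /= eu]] /h0 [_ [v hv /= ev]]; have [_ [aK _]] := ha0.
exists (smul (units_sg A) v (sinv (units_sg A) u)).
  by apply: (sgM (units_sgP A)) => //; apply: (sgV (units_sgP A)).
move=> x; have := eu (a0.1 x); have := ev (a0.1 x); rewrite !aK => -> -> /=.
by rewrite !mulrA -!(mulrA _ u.2 u.1) hu.2 !mulr1.
Qed.

Lemma Qnormal_twist q a b u : sigma q a -> is_aut b -> smem (units_sg A) u ->
  (forall x, b.1 x = u.1 * a.1 x * u.2) -> sigma q b.
Proof.
have [h _] := hsigma; have [a0 [ha0 h0]] := h q.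
move=> /h0 [_ [v hv /= ev]] hb hu eu; apply/h0; split=> //.
exists (smul (units_sg A) u v); first exact: (sgM (units_sgP A)).
by move=> x /=; rewrite eu ev !mulrA.
Qed.

Lemma Qnormal_comp q r a b : sigma q a -> sigma r b ->
  sigma (gmul q r) (a.1 \o b.1, b.2 \o a.2).
Proof. by case: hsigma => _ [h _]; apply: h. Qed.

Lemma Qnormal_res q a s : sigma q a -> a.1 (iota s) = iota (kappa q s).
Proof. by case: hsigma => _ [_ h]; apply: h. Qed.

(** For [a] in [sigma 1], also [a \o a] lies in [sigma 1], so the two differ by an inner
    automorphism; cancelling one [a] shows that [a] itself is inner. [Qnormal_inv] follows the same
    pattern. *)
Lemma Qnormal_id : sigma (gone Q) (@id A, @id A).
Proof.
have [a sa] := Qnormal_ex (gone Q); have ha := Qnormal_aut sa.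
have := Qnormal_comp sa sa; rewrite gmul1g => saa.
have [u hu eu] := Qnormal_inner saa sa.
apply: (Qnormal_twist sa _ hu); first exact: id_is_aut.
by have [_ [_ aK']] := ha; move=> x; have /= := eu (a.2 x); rewrite aK'.
Qed.

Lemma Qnormal_inv q a : sigma q a -> sigma (ginv q) (a.2, a.1).
Proof.
move=> sa; have ha := Qnormal_aut sa; have [b sb] := Qnormal_ex (ginv q).
have := Qnormal_comp sb sa; rewrite gmulVg => sba.
have [u hu eu] := Qnormal_inner sba Qnormal_id.
apply: (Qnormal_twist sb _ hu); first exact: inv_is_aut.
by have [_ [_ aK']] := ha; move=> x; have /= := eu (a.2 x); rewrite aK'.
Qed.

Lemma Bsig_sgP : is_sgroup (Bsig_sg sigma).
Proof.
apply: left_sgroup => /=.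
- by split; [exact: id_is_aut|exact: Qnormal_id].
- move=> [a q] [b r] /= [ha sa] [hb sb].
  by split; [exact: comp_is_aut|exact: Qnormal_comp].
- by move=> [a q] /= [ha sa]; split; [exact: inv_is_aut|exact: Qnormal_inv].
- by move=> x y z _ _ _; rewrite gmulA.
- by move=> [[a a'] q] _ /=; rewrite gmul1g.
- move=> [[a a'] q] /= [[_ [/= aK aK']] _]; rewrite gmulVg.
  by do 2!congr (_, _); apply: functional_extensionality => x /=.
Qed.

Lemma Qnormal_conj u : smem (units_sg A) u -> sigma (gone Q) (conj_aut u).
Proof.
by move=> hu; apply: (Qnormal_twist Qnormal_id _ hu) => //; exact: conj_is_aut.
Qed.

Lemma teich_xextP : is_units_xext (teich_xext iota sigma).
Proof.
have [[i1 [iD iM]] [i_inj iZ]] := hA.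
have hU := units_sgP A; have hB := Bsig_sgP.
split=> //; split=> //.
split.
  split=> [[m m'] [/= h1 h2]|m m' _ _ /=]; last by rewrite !iM.
  by rewrite -!iM h1 h2 i1.
split.
  split=> [u hu|u v hu hv /=]; first by split; [exact: conj_is_aut|exact: Qnormal_conj].
  rewrite gmul1g; congr (_, _); congr (_, _); apply: functional_extensionality => x /=;
    by rewrite !mulrA.
split=> //.
split; first by move=> [a q] u [/= ha _] hu; exact: (aut_unit ha hu).
split; first by move=> [a q] u v [/= ha _] _ _; rewrite !autM.
split=> //.
split; first by case.
split.
  move=> [a q] u [/= ha sa] hu; have [_ [aK aK']] := ha.
  rewrite gmulg1.
  rewrite gmulgV.
  congr (_, _); congr (_, _); apply: functional_extensionality => x /=;
    by rewrite !autM // aK'.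
split; first by move=> c c' _ _ /=; rewrite mulrA.
split; first by move=> [m1 m2] [n1 n2] _ _ [/i_inj -> /i_inj ->].
split.
  move=> [u u'] hu; have [/= uu' u'u] := hu; split=> [[e1 e2]|[[m m'] [/= h1 h2] [-> ->]]].
    (* A unit with trivial conjugation is central, and so is its inverse. Both therefore come from
       [S], and injectivity of [iota] makes their preimages inverse to each other. *)
    have cu x : u * x = x * u.
      by have := congr1 (fun f => f x) e1; rewrite /= => {2}<-; rewrite -!mulrA u'u mulr1.
    have cu' x : u' * x = x * u'.
      by have := congr1 (fun f => f x) e2; rewrite /= => {2}<-; rewrite -!mulrA uu' mulr1.
    have [m em] := (iZ u).1 cu; have [m' em'] := (iZ u').1 cu'.
    exists (m, m'); last by rewrite em em'.
    by split; apply: i_inj; rewrite /= iM -em -em' i1.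
  have cm s x : iota s * x = x * iota s by move: x; apply/iZ; exists s.
  congr (_, _); congr (_, _); apply: functional_extensionality => x /=;
    by rewrite cm -mulrA -iM ?h1 ?h2 i1 mulr1.
split.
  move=> [a q] [/= ha sa]; split=> [eq1|[u hu [_ ->]]] //.
  (* Over [1] the coset [sigma 1] contains the identity, so it consists of inner automorphisms. *)
  rewrite eq1 in sa *; have [u hu eu] := Qnormal_inner Qnormal_id sa.
  by exists u => //; congr (_, _); apply: aut_pair_eq => //; exact: conj_is_aut.
split.
  move=> q _; have [a sa] := Qnormal_ex q; exists (a, q) => //.
  by split=> //; exact: Qnormal_aut sa.
by move=> [a q] [m m'] [/= _ sa] _; rewrite !(Qnormal_res _ sa).
Qed.

(** A factor set of [teich_xext] spelled out: the [Q]-component of the section at [q] must be [q],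
    and equalities of units and automorphisms, stored together with their inverses, are decided by
    the first components. *)
Lemma teich_zeroP : teich_zero kappa iota sigma <->
  exists (alpha : Q -> (A -> A) * (A -> A)) (c : Q -> Q -> A * A),
  [/\ forall q, sigma q (alpha q),
      forall q r, smem (units_sg A) (c q r),
      forall q r x, (alpha q).1 ((alpha r).1 x) =
        (c q r).1 * (alpha (gmul q r)).1 x * (c q r).2 &
      forall q r s, (c q r).1 * (c (gmul q r) s).1 =
        (alpha q).1 (c r s).1 * (c q (gmul r s)).1].
Proof.
apply: (iff_trans (xclass_zeroP teich_xextP trivial_units_xextP)).
split=> [[g [c [hg [gp [hc [gM cM]]]]]]|[alpha [c [ha hc aM cM]]]].
  exists (fun q => (g q).1), c; split=> //.
  - by move=> q; have [_] := hg q; rewrite [(g q).2]gp.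
  - move=> q r x; exact: (congr1 (fun y : sT (Bsig_sg sigma) => y.1.1 x) (gM q r)).
  - by move=> q r s; have [] := cM q r s.
have haut q := Qnormal_aut (ha q).
exists (fun q => (alpha q, q)), c.
split; first by move=> q; split; [exact: haut|exact: ha].
split=> //; split=> //; split=> q r /=.
  rewrite gmul1g; congr (_, _); apply: aut_pair_eq => //.
  - exact: comp_is_aut.
  - exact: comp_is_aut (conj_is_aut (hc q r)) (haut _).
  - by move=> x /=; rewrite aM.
move=> s; apply: (@unit_pair_eq A); last exact: cM.
  exact: (sgM (units_sgP A)).
exact: (sgM (units_sgP A) (aut_unit (haut q) (hc r s)) (hc _ _)).
Qed.
End Normal.
End Teichmueller.

(** * From a strong Deuring embedding to a normal structure with zero class *)

Section DeuringToTeichmueller.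
Variables (S : comPzRingType) (Q : group) (kappa : Q -> S -> S).
Hypothesis hkappa : is_ring_action kappa.
Variables (A : pzRingType) (iota : S -> A).
Hypothesis hA : is_central_alg iota.
Variables (C : pzRingType) (j : A -> C) (chi : Q -> C * C -> Prop).
Hypothesis hD : is_strong_deuring kappa iota j chi.

Lemma deuring_rhom : is_rhom j. Proof. by case: hD. Qed.
Lemma deuring_inj : injective j. Proof. by case: hD => _ []. Qed.
Lemma deuringM x y : j (x * y) = j x * j y. Proof. by case: deuring_rhom => _ []. Qed.
Lemma deuringD x y : j (x + y) = j x + j y. Proof. by case: deuring_rhom => _ []. Qed.
Lemma deuring1 : j 1 = 1. Proof. by case: deuring_rhom. Qed.
Lemma chi_class q : NU_class j (chi q). Proof. by case: hD => _ [_ [_ []]]. Qed.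
Lemma chiM q r n n' : chi q n -> chi r n' -> chi (gmul q r) (n.1 * n'.1, n'.2 * n.2).
Proof. by case: hD => _ [_ [_ [_ [h _]]]]; apply: h. Qed.
Lemma chi_res q n s : chi q n -> n.1 * j (iota s) * n.2 = j (iota (kappa q s)).
Proof. by case: hD => _ [_ [_ [_ [_ h]]]]; apply: h. Qed.

Lemma chi_norm q n : chi q n -> in_normalizer j n.
Proof. by have [n0 [_ h]] := chi_class q => /h []. Qed.

Lemma chi_unit q n : chi q n -> smem (units_sg C) n.
Proof. by move=> /chi_norm []. Qed.

Lemma chi_ex q : exists n, chi q n.
Proof.
have [n0 [h0 h]] := chi_class q; exists n0; apply/h; split=> //.
by exists (1, 1); rewrite /= ?mulr1 // deuring1 mulr1 mul1r; case: n0 {h0 h}.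
Qed.

Lemma deuring_unit u : smem (units_sg A) u -> smem (units_sg C) (j u.1, j u.2).
Proof. by move=> [h1 h2]; rewrite /= -!deuringM h1 h2 deuring1. Qed.

(** The two clauses of [in_normalizer] yield by choice a map and a candidate inverse on [A];
    injectivity of [j] makes them mutually inverse and compatible with the ring operations. *)
Lemma norm_aut n : in_normalizer j n ->
  exists2 a, is_aut a & forall x, j (a.1 x) = n.1 * j x * n.2.
Proof.
move=> [[nn' n'n] [h1 h2]].
have [f fP] := functional_choice _ h1; have [f' f'P] := functional_choice _ h2.
have nI x y : n.1 * j x * n.2 = n.1 * j y * n.2 -> x = y.
  move=> /(congr1 (fun z => n.2 * z * n.1)); rewrite !mulrA n'n !mul1r -!mulrA n'n !mulr1.
  exact: deuring_inj.
exists (f, f') => //; split; last first.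
  split=> x /=; first by apply: nI; rewrite f'P fP.
  by apply: deuring_inj; rewrite -fP f'P.
split; first by apply: deuring_inj; rewrite -fP deuring1 mulr1.
split=> x y; apply: deuring_inj; first by rewrite deuringD -!fP deuringD mulrDr mulrDl.
by rewrite deuringM -!fP deuringM !mulrA -!(mulrA _ n.2 n.1) n'n mulr1.
Qed.

(** Elements of one coset differ by a unit [w] of [A] on the right. With [a] the automorphism
    induced by [n], [n w = a(w) n] moves it to the left. *)
Lemma chi_quot q n n' : chi q n -> chi q n' ->
  exists2 u, smem (units_sg A) u & n'.1 = j u.1 * n.1.
Proof.
move=> hn hn'; have [a ha ea] := norm_aut (chi_norm hn).
have [n0 [[[n0V n0V'] _] h]] := chi_class q.
have [_ [u hu eu]] := (h n).1 hn; have [_ [v hv ev]] := (h n').1 hn'.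
have hw : smem (units_sg A) (u.2 * v.1, v.2 * u.1).
  exact: (sgM (units_sgP A) (sgV (units_sgP A) hu) hv).
exists (a.1 (u.2 * v.1), a.1 (v.2 * u.1)); first exact: (aut_unit ha hw).
have [_ n'n] := chi_unit hn.
rewrite /= ea -mulrA n'n mulr1 eu ev /= deuringM mulrA -(mulrA _ (j u.1)) -deuringM.
by rewrite hu.1 deuring1 mulr1.
Qed.

Lemma chi_mulr q n u : chi q n -> smem (units_sg A) u -> 
  chi q (n.1 * j u.1, j u.2 * n.2).
Proof.
move=> hn hu; have [n0 [h0 h]] := chi_class q.
have [hN [v hv ev]] := (h n).1 hn; apply/h; split; last first.
  exists (smul (units_sg A) v u); first exact: (sgM (units_sgP A)).
  by rewrite ev /= !deuringM !mulrA.
have [hnU [h1 h2]] := hN.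
split; first exact: (sgM (units_sgP C) hnU (deuring_unit hu)).
split=> a /=.
  have [b eb] := h1 (u.1 * a * u.2); exists b.
  by rewrite -eb !deuringM !mulrA.
have [b eb] := h2 a; exists (u.2 * b * u.1).
rewrite -eb !deuringM !mulrA -(mulrA n.1) -deuringM hu.1 deuring1 mulr1.
by rewrite -(mulrA _ (j u.1) (j u.2)) -deuringM hu.1 deuring1 mulr1.
Qed.

Lemma induced_teich_zero sigma : is_Qnormal kappa iota sigma ->
  induces_normal j chi sigma -> teich_zero kappa iota sigma.
Proof.
move=> hs hi; apply/(teich_zeroP hkappa hA hs).
have [n hn] := functional_choice _ chi_ex.
have h q : exists a, sigma q a /\ forall x, j (a.1 x) = (n q).1 * j x * (n q).2.
  by have [a sa ea] := hi q _ (hn q); exists a.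
have [alpha aP] := functional_choice _ h.
have aE q x : j ((alpha q).1 x) = (n q).1 * j x * (n q).2 by case: (aP q).
(* Both [n q n r] and [n (q r)] represent [chi (q r)]; the unit comparing them is the value of the
   factor set. *)
have h2 (p : Q * Q) : exists u, smem (units_sg A) u /\
    (n p.1).1 * (n p.2).1 = j u.1 * (n (gmul p.1 p.2)).1.
  have [u hu eu] := chi_quot (hn (gmul p.1 p.2)) (chiM (hn p.1) (hn p.2)).
  by exists u.
have [c cP] := functional_choice _ h2.
have hc q r : smem (units_sg A) (c (q, r)) by case: (cP (q, r)).
have cE q r : (n q).1 * (n r).1 = j (c (q, r)).1 * (n (gmul q r)).1 by case: (cP (q, r)).
have cE' q r : (n r).2 * (n q).2 = (n (gmul q r)).2 * j (c (q, r)).2.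
  have hq := chi_unit (hn q); have hr := chi_unit (hn r).
  have := @unit_pair_eq C _ _ (sgM (units_sgP C) hq hr)
    (sgM (units_sgP C) (deuring_unit (hc q r)) (chi_unit (hn (gmul q r)))) (cE q r).
  by case.
have nV q : (n q).2 * (n q).1 = 1 by case: (chi_unit (hn q)).
have nV' q : (n q).1 * (n q).2 = 1 by case: (chi_unit (hn q)).
exists alpha, (fun q r => c (q, r)); split=> //.
- by move=> q; case: (aP q).
- move=> q r x; apply: deuring_inj; rewrite !deuringM !aE !mulrA cE -!mulrA cE'.
  by rewrite !mulrA.
- move=> q r s; apply: deuring_inj; rewrite !deuringM aE.
  have nI x y : x * (n (gmul (gmul q r) s)).1 = y * (n (gmul (gmul q r) s)).1 -> x = y.
    move=> /(congr1 (fun z => z * (n (gmul (gmul q r) s)).2)).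
    by rewrite -!mulrA nV' !mulr1.
  (* After multiplication by [n (q r s)], both sides reduce to the triple product [n q n r n s]. *)
  apply: nI; rewrite -mulrA -cE mulrA -cE.
  rewrite -gmulA -[RHS]mulrA -cE [RHS]mulrA -(mulrA _ (n q).2) nV mulr1.
  by rewrite -[RHS]mulrA -cE mulrA.
Qed.

(** The composite of [chi] with the map to outer automorphisms induced by conjugation, each value
    given as a set of automorphisms. *)
Definition deuring_normal (q : Q) (a : (A -> A) * (A -> A)) : Prop :=
  is_aut a /\ exists2 n, chi q n & forall x, j (a.1 x) = n.1 * j x * n.2.

Lemma deuring_induces : induces_normal j chi deuring_normal.
Proof.
move=> q n hn; have [a ha ea] := norm_aut (chi_norm hn).
by exists a => //; split=> //; exists n.
Qed.

Lemma deuring_normalP : is_Qnormal kappa iota deuring_normal.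
Proof.
split; [|split].
- move=> q; have [n hn] := chi_ex q; have [a0 ha0 e0] := norm_aut (chi_norm hn).
  have [_ [aK aK']] := ha0; have [_ n'n] := chi_unit hn.
  exists a0; split=> // b; split=> [[hb [m hm em]]|[hb [u hu eu]]].
    split=> //; have [u hu eu] := chi_quot hn hm; exists u => // x /=.
    apply: deuring_inj; rewrite em.
    have -> : m = (j u.1 * n.1, n.2 * j u.2).
      apply: (@unit_pair_eq C) => //; first exact: (chi_unit hm).
      exact: (sgM (units_sgP C) (deuring_unit hu) (chi_unit hn)).
    have ex : j x = n.1 * j (a0.2 x) * n.2 by rewrite -e0 aK'.
    by rewrite !deuringM ex /= !mulrA.
  split=> //; have hai := inv_is_aut ha0.
  have hv := aut_unit hai hu.
  (* This is [j u n], rewritten with the unit on the right so that it visibly stays in the coset of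
     [n]. *)
  exists (n.1 * j (a0.2 u.1), j (a0.2 u.2) * n.2); first exact: (chi_mulr hn hv).
  move=> x; have /= := eu (a0.1 x); rewrite aK => -> /=.
  rewrite !deuringM e0.
  have ex y : j y = n.1 * j (a0.2 y) * n.2 by rewrite -e0 aK'.
  by rewrite (ex u.1) (ex u.2) !mulrA -!(mulrA _ n.2 n.1) n'n !mulr1.
- move=> q r a b [ha [n hn en]] [hb [m hm em]]; split; first exact: comp_is_aut.
  exists (n.1 * m.1, m.2 * n.2); first exact: chiM.
  by move=> x /=; rewrite en em !mulrA.
- move=> q a s [ha [n hn en]]; apply: deuring_inj; rewrite en; exact: chi_res.
Qed.
End DeuringToTeichmueller.

(** * The ring of endomorphisms of the functions from [Q] to [A] that are linear over given
    scalars *)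

Section FunctionEndomorphisms.
Variables (Q : Type) (A : pzRingType) (K : A -> Prop).
Local Notation V := (Q -> A).

(** Linearity over [K] makes left multiplication by an element of [K] commute with every
    endomorphism. With [K] the image of the fixed ring of [Q], the endomorphism ring is thus an
    algebra over that ring. *)
Definition fun_linear (f : V -> V) : Prop :=
  (forall x y, f (fun q => x q + y q) = fun q => f x q + f y q) /\
  (forall k, K k -> forall x, f (fun q => k * x q) = fun q => k * f x q).

Record fun_endo := FunEndo { endo_fun :> V -> V; endo_linear : fun_linear endo_fun }.
Implicit Types f g h : fun_endo.

Lemma fun_endo_eq f g : (forall x q, f x q = g x q) -> f = g.
Proof.
case: f g => [f hf] [g hg] /= e.
have {}e : f = g by do 2![apply: functional_extensionality => ?].
by rewrite e in hf *; congr FunEndo; exact: Prop_irrelevance.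
Qed.

Lemma endoD f x y : f (fun q => x q + y q) = fun q => f x q + f y q.
Proof. by case: (endo_linear f). Qed.
Lemma endoK f k x : K k -> f (fun q => k * x q) = fun q => k * f x q.
Proof. by case: (endo_linear f) => _ h /h. Qed.

HB.instance Definition _ := gen_eqMixin fun_endo.
HB.instance Definition _ := gen_choiceMixin fun_endo.

Lemma endo_zero_linear : fun_linear (fun _ _ => 0).
Proof.
by split=> *; apply: functional_extensionality => q; rewrite ?addr0 ?mulr0.
Qed.
Lemma endo_add_linear f g : fun_linear (fun x q => f x q + g x q).
Proof.
split=> *; apply: functional_extensionality => q; first by rewrite !endoD addrACA.
by rewrite !endoK // mulrDr.
Qed.
Lemma endo_opp_linear f : fun_linear (fun x q => - f x q).
Proof.
split=> *; apply: functional_extensionality => q; first by rewrite !endoD opprD.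
by rewrite !endoK // mulrN.
Qed.
Lemma endo_id_linear : fun_linear id. Proof. by []. Qed.
Lemma endo_comp_linear f g : fun_linear (f \o g).
Proof. by split=> * /=; rewrite ?endoD ?endoK. Qed.

Definition endo_zero := FunEndo endo_zero_linear.
Definition endo_add f g := FunEndo (endo_add_linear f g).
Definition endo_opp f := FunEndo (endo_opp_linear f).
Definition endo_id := FunEndo endo_id_linear.
Definition endo_comp f g := FunEndo (endo_comp_linear f g).

Lemma endo_addA : associative endo_add.
Proof. by move=> f g h; apply: fun_endo_eq => x q /=; rewrite addrA. Qed.
Lemma endo_addC : commutative endo_add.
Proof. by move=> f g; apply: fun_endo_eq => x q /=; rewrite addrC. Qed.
Lemma endo_add0 : left_id endo_zero endo_add.
Proof. by move=> f; apply: fun_endo_eq => x q /=; rewrite add0r. Qed.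
Lemma endo_addN : left_inverse endo_zero endo_opp endo_add.
Proof. by move=> f; apply: fun_endo_eq => x q /=; rewrite addNr. Qed.
HB.instance Definition _ :=
  GRing.isZmodule.Build fun_endo endo_addA endo_addC endo_add0 endo_addN.

Lemma endo_compA : associative endo_comp.
Proof. by move=> f g h; apply: fun_endo_eq. Qed.
Lemma endo_comp1f : left_id endo_id endo_comp.
Proof. by move=> f; apply: fun_endo_eq. Qed.
Lemma endo_compf1 : right_id endo_id endo_comp.
Proof. by move=> f; apply: fun_endo_eq. Qed.
Lemma endo_compDl : left_distributive endo_comp +%R.
Proof. by move=> f g h; apply: fun_endo_eq. Qed.
(** The one ring identity that rests on additivity of the maps. *)
Lemma endo_compDr : right_distributive endo_comp +%R.
Proof. by move=> f g h; apply: fun_endo_eq => x q /=; rewrite endoD. Qed.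
HB.instance Definition _ := GRing.Zmodule_isPzRing.Build fun_endo
  endo_compA endo_comp1f endo_compf1 endo_compDl endo_compDr.
End FunctionEndomorphisms.

(** * From a factor set to a strong Deuring embedding, by the action of the crossed product *)

Section CrossedProduct.
Variables (S : comPzRingType) (Q : group) (kappa : Q -> S -> S).
Hypothesis hkappa : is_ring_action kappa.
Variables (A : pzRingType) (iota : S -> A).
Hypothesis hA : is_central_alg iota.
Variable sigma : Q -> (A -> A) * (A -> A) -> Prop.
Hypothesis hsigma : is_Qnormal kappa iota sigma.
Variables (alpha : Q -> (A -> A) * (A -> A)) (c : Q -> Q -> A * A).
Hypotheses (ha : forall q, sigma q (alpha q))
  (hc : forall q r, smem (units_sg A) (c q r))
  (aM : forall q r x, (alpha q).1 ((alpha r).1 x) =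
        (c q r).1 * (alpha (gmul q r)).1 x * (c q r).2)
  (cM : forall q r s, (c q r).1 * (c (gmul q r) s).1 =
        (alpha q).1 (c r s).1 * (c q (gmul r s)).1).

Definition fixed_scalar (a : A) : Prop :=
  exists2 s, (forall q, kappa q s = s) & a = iota s.

Local Notation C := (fun_endo Q fixed_scalar).
Let haut q := Qnormal_aut hsigma (ha q).

Lemma fixed_scalar_central k a : fixed_scalar k -> k * a = a * k.
Proof.
by move=> [s _ ->]; have [_ [_ h]] := hA; move: a; apply/h; exists s.
Qed.

Lemma fixed_scalar_aut q k : fixed_scalar k -> (alpha q).1 k = k.
Proof. by move=> [s hs ->]; rewrite (Qnormal_res hsigma _ (ha q)) hs. Qed.

Lemma lmul_linear a : fun_linear fixed_scalar (fun (x : Q -> A) q => a * x q).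
Proof.
split=> *; apply: functional_extensionality => q; first by rewrite mulrDr.
by rewrite mulrA -(fixed_scalar_central a) // mulrA.
Qed.
Definition lmul_endo (a : A) : C := FunEndo (lmul_linear a).

(* Left multiplication by the basis element [u_p] of the crossed product, where
   [u_p a = alpha_p(a) u_p] and [u_p u_q = c(p, q) u_pq]; as it permutes the coordinates,
   it makes sense on all functions [Q -> A], not only the finitely supported ones. *)
Lemma shift_linear p : fun_linear fixed_scalar (fun (x : Q -> A) r =>
  (alpha p).1 (x (gmul (ginv p) r)) * (c p (gmul (ginv p) r)).1).
Proof.
have hp := haut p; split=> *; apply: functional_extensionality => q.
  by rewrite autD // mulrDl.
by rewrite autM // fixed_scalar_aut // mulrA.
Qed.
Definition shift_endo p : C := FunEndo (shift_linear p).

(** The inverse of the shift: the function [y] with [alpha_p(y(r)) c(p, r) = x(p r)] for all [r]. *)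
Lemma unshift_linear p : fun_linear fixed_scalar (fun (x : Q -> A) r =>
  (alpha p).2 (x (gmul p r) * (c p r).2)).
Proof.
have hp := inv_is_aut (haut p); have [_ [/= aK' aK]] := hp.
split=> [x y|k hk x]; apply: functional_extensionality => q.
  by rewrite mulrDl; exact: (autD _ _ hp).
rewrite -mulrA; have /= -> := autM k (x (gmul p q) * (c p q).2) hp.
by rewrite -{1}(fixed_scalar_aut p hk) aK.
Qed.
Definition unshift_endo p : C := FunEndo (unshift_linear p).

Definition cross_unit p : C * C := (shift_endo p, unshift_endo p).

Lemma groupK (p r : Q) : gmul (ginv p) (gmul p r) = r.
Proof. by rewrite gmulA gmulVg gmul1g. Qed.
Lemma groupKV (p r : Q) : gmul p (gmul (ginv p) r) = r.
Proof. by rewrite gmulA gmulgV gmul1g. Qed.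

Lemma cross_unitP p : smem (units_sg C) (cross_unit p).
Proof.
have [_ [aK aK']] := haut p.
split; apply: fun_endo_eq => x r /=.
  by rewrite aK' groupKV -mulrA (hc _ _).2 mulr1.
by rewrite groupK -mulrA (hc _ _).1 mulr1 aK.
Qed.

Lemma shift_lmul p a : shift_endo p * lmul_endo a = lmul_endo ((alpha p).1 a) * shift_endo p.
Proof.
by apply: fun_endo_eq => x r /=; rewrite autM // mulrA.
Qed.

Lemma shiftM p q :
  shift_endo p * shift_endo q = lmul_endo (c p q).1 * shift_endo (gmul p q).
Proof.
apply: fun_endo_eq => x r /=.
have -> : gmul (ginv (gmul p q)) r = gmul (ginv q) (gmul (ginv p) r).
  by rewrite -{2}(groupKV (gmul p q) r) -gmulA !groupK.
(* With [r = p q t], both sides evaluate [x] at [t], and their equality at [r] becomes the cocycle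
   identity for [(p, q, t)]. *)
set t := gmul (ginv q) _.
have tE : gmul (ginv p) r = gmul q t by rewrite /t groupKV.
rewrite [X in c p X]tE autM // aM -!mulrA; congr (_ * (_ * _)).
by rewrite -cM !mulrA (hc _ _).2 mul1r.
Qed.

Lemma lmul_rhom : is_rhom lmul_endo.
Proof.
split; [|split] => *; apply: fun_endo_eq => x r /=;
  by rewrite ?mul1r ?mulrDl ?mulrA.
Qed.

Lemma lmul_inj : injective lmul_endo.
Proof.
move=> a b /(congr1 (fun f : C => f (fun=> 1) (gone Q))) /=.
by rewrite !mulr1.
Qed.

Lemma lmulM a b : lmul_endo (a * b) = lmul_endo a * lmul_endo b.
Proof. by case: lmul_rhom => _ []. Qed.
Lemma lmul1 : lmul_endo 1 = 1.
Proof. by case: lmul_rhom. Qed.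
Lemma lmul_unit u : smem (units_sg A) u ->
  smem (units_sg C) (lmul_endo u.1, lmul_endo u.2).
Proof. by move=> [h1 h2]; rewrite /= -!lmulM h1 h2 lmul1. Qed.

Definition cross_chi (q : Q) (n : C * C) : Prop :=
  exists2 u, smem (units_sg A) u &
    n = ((cross_unit q).1 * lmul_endo u.1, lmul_endo u.2 * (cross_unit q).2).

Lemma cross_conj q u a : smem (units_sg A) u ->
  (cross_unit q).1 * lmul_endo u.1 * lmul_endo a * (lmul_endo u.2 * (cross_unit q).2) =
  lmul_endo ((alpha q).1 (u.1 * a * u.2)).
Proof.
move=> hu; have [h _] := cross_unitP q; rewrite mulrA.
have -> : (cross_unit q).1 * lmul_endo u.1 * lmul_endo a * lmul_endo u.2 =
    (cross_unit q).1 * lmul_endo (u.1 * a * u.2) by rewrite !lmulM !mulrA.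
by rewrite [X in X * _]shift_lmul -mulrA [X in _ * X]h mulr1.
Qed.

Lemma cross_chi_norm q n : cross_chi q n -> in_normalizer lmul_endo n.
Proof.
move=> [u hu ->]; have [_ [_ aK']] := haut q.
split; first exact: (sgM (units_sgP C) (cross_unitP q) (lmul_unit hu)).
split=> a /=; first by eexists; apply: cross_conj.
exists (u.2 * (alpha q).2 a * u.1); rewrite cross_conj //.
by rewrite !mulrA hu.1 mul1r -mulrA hu.1 mulr1 aK'.
Qed.

Lemma cross_deuring : is_strong_deuring kappa iota lmul_endo cross_chi.
Proof.
split; first exact: lmul_rhom.
split; first exact: lmul_inj.
split.
  move=> s hs f; apply: fun_endo_eq => x r /=.
  by rewrite endoK //; exists s.
split.
  move=> q; exists (cross_unit q); split.
    apply: (@cross_chi_norm q); exists (1, 1); first by rewrite /= mulr1.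
    by rewrite lmul1 mulr1 mul1r.
  move=> n; split=> [hn|[_ [u hu ->]]]; last by exists u.
  by split; [exact: (cross_chi_norm hn)|case: hn => u hu ->; exists u].
split.
  move=> q r n m hn hm.
  have hnm := sgM (units_sgP C) (cross_chi_norm hn).1 (cross_chi_norm hm).1.
  case: hn hm hnm => u hu -> [v hv ->] hnm.
  have [_ [aK aK']] := haut r; have hr' := inv_is_aut (haut r).
  have [_ [bK bK']] := haut (gmul q r); have hqr' := inv_is_aut (haut (gmul q r)).
  (* Moving units of [A] to the right turns [u_q u u_r v] into [u_qr w]: [u] passes [u_r] through
     the inverse of [alpha r], and [c q r] passes [u_qr] through the inverse of [alpha (q r)]. *)
  pose w := smul (units_sg A) (smul (units_sg A)
    ((alpha (gmul q r)).2 (c q r).1, (alpha (gmul q r)).2 (c q r).2)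
    ((alpha r).2 u.1, (alpha r).2 u.2)) v.
  have hw : smem (units_sg A) w.
    apply: (sgM (units_sgP A)) => //.
    exact: (sgM (units_sgP A) (aut_unit hqr' (hc q r)) (aut_unit hr' hu)).
  exists w => //; apply: (@unit_pair_eq C) => //.
    exact: (sgM (units_sgP C) (cross_unitP _) (lmul_unit hw)).
  rewrite /w /= !lmulM !mulrA.
  rewrite [X in _ = X * _ * _]shift_lmul bK' -shiftM.
  by rewrite -[in RHS](mulrA (shift_endo q)) [in RHS]shift_lmul aK' !mulrA.
move=> q n s [u hu ->] /=; rewrite cross_conj //.
have [[_ [_ iM]] [_ h]] := hA.
have cs x : iota s * x = x * iota s by move: x; apply/h; exists s.
by rewrite -cs -mulrA hu.1 mulr1 (Qnormal_res hsigma _ (ha q)).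
Qed.

Lemma cross_induces : induces_normal lmul_endo cross_chi sigma.
Proof.
move=> q n [u hu ->].
(* Conjugation by [u_q u] is [alpha q] after conjugation by [u]; it lies in [sigma (q 1)]. *)
exists ((alpha q).1 \o (conj_aut u).1, (conj_aut u).2 \o (alpha q).2).
  have := Qnormal_comp hsigma (ha q) (Qnormal_conj hsigma hu).
  by rewrite gmulg1.
by move=> x; rewrite cross_conj.
Qed.
End CrossedProduct.

(** * The equivalence for a given normal structure and for an unspecified one *)

Theorem theorem1p6p4 (S : comPzRingType) (Q : group) (kappa : Q -> S -> S)
  (hkappa : is_ring_action kappa) (A : pzRingType) (iota : S -> A)
  (hA : is_central_alg iota) :
  (forall sigma : Q -> (A -> A) * (A -> A) -> Prop,
     is_Qnormal kappa iota sigma ->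
     (teich_zero kappa iota sigma <->
      exists (C : pzRingType) (j : A -> C) (chi : Q -> C * C -> Prop),
        is_strong_deuring kappa iota j chi /\ induces_normal j chi sigma)) /\
  ((exists (C : pzRingType) (j : A -> C) (chi : Q -> C * C -> Prop),
      is_strong_deuring kappa iota j chi) <->
   exists sigma : Q -> (A -> A) * (A -> A) -> Prop,
     is_Qnormal kappa iota sigma /\ teich_zero kappa iota sigma).
Proof.
have main sigma : is_Qnormal kappa iota sigma -> (teich_zero kappa iota sigma <->
    exists (C : pzRingType) (j : A -> C) (chi : Q -> C * C -> Prop),
      is_strong_deuring kappa iota j chi /\ induces_normal j chi sigma).
  move=> hs; split=> [/(teich_zeroP hkappa hA hs) [alpha [c [ha hc aM cM]]]|].
    exists (fun_endo Q (fixed_scalar kappa iota)), (lmul_endo kappa hA).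
    exists (cross_chi hA hs c ha); split; first exact: cross_deuring.
    exact: cross_induces.
  by move=> [C [j [chi [hD hi]]]]; exact: (induced_teich_zero hkappa hA hD hs hi).
split=> //; split=> [[C [j [chi hD]]]|[sigma [hs /(main _ hs)]]].
  (* When no structure is prescribed, the one induced by the embedding itself is taken. *)
  exists (deuring_normal j chi); have hs := deuring_normalP hD; split=> //.
  exact: (induced_teich_zero hkappa hA hD hs (deuring_induces hD)).
by move=> [C [j [chi [hD _]]]]; exists C, j, chi.
Qed.
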